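(* Let $s\ge2$ be an integer and let $X\subset\mathbb{R}^{1,1}$ be a subset (not assumed finite) with $|A(X)|=s$, where $0\in A(X)$ is allowed. Then $X$ is finite.
   Context: $\mathbb{R}^{1,1}$ is $\mathbb{R}^2$ with the bilinear form $\langle\langle x,y\rangle\rangle=x_1y_1-x_2y_2$, and $\|x\|:=\langle\langle x,x\rangle\rangle=x_1^2-x_2^2$. For $X\subset\mathbb{R}^{1,1}$, $A(X)=\{\|x-y\| : x,y\in X,\ x\ne y\}$. *)

(* Defs.v *)
From HB Require Import structures.
From mathcomp Require Import all_boot all_order all_algebra.
From mathcomp Require Import all_classical all_reals.

Set Implicit Arguments.
Unset Strict Implicit.
Unset Printing Implicit Defensive.

Import Order.TTheory GRing.Theory Num.Theory.

Local Open Scope classical_set_scope.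
Local Open Scope ring_scope.

(* The underlying space of R^{1,1} is 'rV[R]_2; the coordinates x_1 and x_2   *)
(* are the entries x 0 0 and x 0 1.                                           *)
Definition lorentz (R : realType) (x y : 'rV[R]_2) : R :=
  x 0 0 * y 0 0 - x 0 1 * y 0 1.

(* No square root is taken, so this may be negative, or zero at nonzero x.    *)
Definition lorentz_norm (R : realType) (x : 'rV[R]_2) : R := lorentz x x.

Definition distance_set (R : realType) (X : set 'rV[R]_2) : set R :=
  [set a | exists x y, [/\ X x, X y, x <> y & a = lorentz_norm (x - y)]].

(* Main.v *)
Require Import Defs.
From HB Require Import structures.
From mathcomp Require Import all_boot all_order all_algebra.
From mathcomp Require Import all_classical all_reals.
From mathcomp Require Import ring.

Set Implicit Arguments.
Unset Strict Implicit.
Unset Printing Implicit Defensive.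

Import Order.TTheory GRing.Theory Num.Theory.

Local Open Scope classical_set_scope.
Local Open Scope card_scope.
Local Open Scope ring_scope.

(** Two points p and q of X at nonzero distance act as a coordinate system: a
    point x of the plane is determined by its distances to p and to q and by
    the side of the line pq on which it lies ([distances_side_inj]).  Indeed,
    with w = x - p and d = q - p, the two distances give the product of w and
    d, and the Lagrange identity [lorentz_lagrange] then gives the square of
    their determinant; since d is not isotropic, the product and the
    determinant together determine w.  As x runs over X, both distances stay
    in the finite set A(X) together with 0, so X embeds in a finite set.
    Points p and q exist because A(X) has at least two elements, one of which
    is nonzero. *)

Section Plane.
Variable R : realType.
Implicit Types (d p q w x y : 'rV[R]_2).

Definition det2 w d : R := w 0 0 * d 0 1 - w 0 1 * d 0 0.

Lemma lorentz_lagrange w d :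
  det2 w d ^+ 2 = lorentz w d ^+ 2 - lorentz_norm w * lorentz_norm d.
Proof. rewrite /det2 /lorentz_norm /lorentz; ring. Qed.

Lemma lorentz_polarization w d :
  lorentz_norm (w - d) = lorentz_norm w - lorentz w d *+ 2 + lorentz_norm d.
Proof. rewrite /lorentz_norm /lorentz !mxE; ring. Qed.

(** The linear map sending w to its product and determinant with d has
    determinant minus the norm of d, so it is injective when d is not
    isotropic. *)
Lemma lorentz_det2_inj d x y : lorentz_norm d != 0 ->
  lorentz x d = lorentz y d -> det2 x d = det2 y d -> x = y.
Proof.
move=> d0 eL eD.
(* Cramer's rule for each coordinate. *)
have E0 w : lorentz_norm d * w 0 0 = lorentz w d * d 0 0 - det2 w d * d 0 1.
  by rewrite /lorentz_norm /lorentz /det2; ring.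
have E1 w : lorentz_norm d * w 0 1 = lorentz w d * d 0 1 - det2 w d * d 0 0.
  by rewrite /lorentz_norm /lorentz /det2; ring.
apply/rowP => i; apply: (mulfI d0).
have [->|->] : i = 0 \/ i = 1.
  by case: i => [[|[|//]] Hi]; [left|right]; apply: val_inj.
- by rewrite !E0 eL eD.
- by rewrite !E1 eL eD.
Qed.

Lemma sqr_ge0_inj (a b : R) :
  a ^+ 2 = b ^+ 2 -> (0 <= a) = (0 <= b) -> a = b.
Proof.
move=> /eqP; rewrite eqf_sqr => /orP[/eqP //|/eqP ->].
rewrite oppr_ge0; case: (ltgtP b 0) => // -> _; exact: oppr0.
Qed.

Definition distances_side p q x : R * R * bool :=
  (lorentz_norm (x - p), lorentz_norm (x - q), 0 <= det2 (x - p) (q - p)).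

(** Both [lorentz (x - p) (q - p)] and the square of the determinant are
    functions of the two distances; the side picks the sign of the square
    root. *)
Lemma distances_side_inj p q :
  lorentz_norm (q - p) != 0 -> injective (distances_side p q).
Proof.
move=> d0 x y [ep eq es].
have shift w : w - q = (w - p) - (q - p) by rewrite opprB addrA subrK.
have eL : lorentz (x - p) (q - p) = lorentz (y - p) (q - p).
  move: eq; rewrite !shift !(lorentz_polarization _ (q - p)) ep.
  move=> /addIr /addrI /oppr_inj.
  by move/eqP; rewrite eqrMn2r => /eqP.
apply: (addIr (- p)); apply: (lorentz_det2_inj d0 eL).
by apply: sqr_ge0_inj es; rewrite !lorentz_lagrange eL ep.
Qed.

Lemma lorentz_norm0 : lorentz_norm (0 : 'rV[R]_2) = 0.
Proof. by rewrite /lorentz_norm /lorentz !mxE; ring. Qed.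

(** The value 0 is added for the case x = y: it need not be in A(X). *)
Lemma lorentz_norm_distance_set (X : set 'rV[R]_2) x y :
  X x -> X y -> (distance_set X `|` [set 0]) (lorentz_norm (x - y)).
Proof.
move=> Xx Xy; have [->|/eqP xy] := eqVneq x y; last by left; exists x, y.
by right; rewrite /= subrr lorentz_norm0.
Qed.

Lemma finite_set_distance (X : set 'rV[R]_2) p q :
  finite_set (distance_set X) -> X p -> X q -> lorentz_norm (q - p) != 0 ->
  finite_set X.
Proof.
move=> finA Xp Xq d0; pose B := distance_set X `|` [set 0].
have finB : finite_set B by rewrite finite_setU; split.
have finC : finite_set (B `*` B `*` [set: bool]).
  by apply: finite_setX => //; exact: finite_setX.
have inj : {in distances_side p q @^-1` (B `*` B `*` [set: bool]) &,
    injective (distances_side p q)}.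
  by move=> x y _ _; exact: distances_side_inj.
apply: sub_finite_set (finite_preimage inj finC) => x Xx.
by do 2![split=> //=]; exact: lorentz_norm_distance_set.
Qed.

End Plane.

Theorem mainTheorem8 (R : realType) (s : nat) (hs : (2 <= s)%N)
  (X : set 'rV[R]_2) (hX : distance_set X #= `I_s) :
  finite_set X.
Proof.
have finA : finite_set (distance_set X) by exists s.
have [[_ [[q [p [Xq Xp _ ->]]] d0]]|A0] :=
    pselect (exists a, distance_set X a /\ a != 0).
  exact: finite_set_distance finA Xp Xq d0.
(* Otherwise A(X) has at most one element, against 2 <= s. *)
have sub0 : distance_set X `<=` [set 0].
  by move=> a Aa; apply: contrapT => /eqP a0; apply: A0; exists a.
have := subset_card_le sub0.
by rewrite (card_le_eql hX) (card_le_eqr card_set1) card_le_II leqNgt hs.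
Qed.
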